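(* Let $n\ge2$, $\delta,\sigma\in\mathbb{R}$ with $\sigma\ne0$, and $T=(n;\delta,\sigma)$ with eigenvalues $\lambda_1,\dots,\lambda_n$. Let $k\in\{1,\dots,n\}$ be such that $|\lambda_k|<|\lambda_j|$ for all $j=1,\dots,n$, $j\neq k$, and let $h\in\{1,\dots,n\}$ be such that $$\frac{|\lambda_h|}{\kappa^{\mathcal{T}}(\lambda_h)}\le\frac{|\lambda_j|}{\kappa^{\mathcal{T}}(\lambda_j)},\qquad j=1,\dots,n.$$ Then $$|\lambda_k|=d_2(T)\le d_2^{\mathcal{T}}(T)\le\frac{|\lambda_h|}{n-1+2n\cos^2\frac{h\pi}{n+1}}\left(n-1+2n\left|\cos\frac{h\pi}{n+1}\right|\cos\frac{\pi}{n+1}\right).$$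
   Context: $(n;d,s)$ denotes the $n\times n$ real symmetric tridiagonal Toeplitz matrix with all diagonal entries equal to $d$ and all sub- and superdiagonal entries equal to $s$. $\mathcal{T}\subset\mathbb{R}^{n\times n}$ is the linear subspace of all such matrices ($d,s\in\mathbb{R}$), and $\mathcal{S}\subset\mathbb{R}^{n\times n}$ is the set of singular matrices. The eigenvalues of $T=(n;\delta,\sigma)$ are numbered as $\lambda_h=\delta+2\sigma\cos\frac{h\pi}{n+1}$, $h=1,\dots,n$. With $\|\cdot\|_2$ the spectral norm, $d_2(T)=\min_{S\in\mathcal{S}}\|T-S\|_2$ and $d_2^{\mathcal{T}}(T)=\min_{S\in\mathcal{S}\cap\mathcal{T}}\|T-S\|_2$. For $\sigma\ne0$, the structured condition number of $\lambda_h$, with $\mathbf{x}_h$ a real unit-norm eigenvector of $T$ for $\lambda_h$, is $\kappa^{\mathcal{T}}(\lambda_h)=\max_{E\in\mathcal{T},\,\|E\|_F=1}|\mathbf{x}_h^TE\mathbf{x}_h|=\sqrt{\frac1n+\frac{2}{n-1}\cos^2\frac{h\pi}{n+1}}$, where $\|\cdot\|_F$ is the Frobenius norm. *)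

(* Defs.v *)
From HB Require Import structures.
From mathcomp Require Import all_boot all_order all_algebra.
From mathcomp Require Import all_classical all_reals all_analysis.
From mathcomp Require Import ring lra.

Set Implicit Arguments.
Unset Strict Implicit.
Unset Printing Implicit Defensive.

Import Order.TTheory GRing.Theory Num.Theory.
Import numFieldNormedType.Exports.
Local Open Scope classical_set_scope.
Local Open Scope ring_scope.

Definition tridiag (R : realType) (n : nat) (d s : R) : 'M[R]_n :=
  \matrix_(i < n, j < n)
    if i == j then d
    else if ((i.+1 == j :> nat) || (j.+1 == i :> nat))%N then s
    else 0.

Definition tridiagToeplitz (R : realType) (n : nat) : set 'M[R]_n :=
  [set A | exists d s : R, A = tridiag n d s].

Definition singular (R : realType) (n : nat) : set 'M[R]_n :=
  [set A | A \notin unitmx].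

(* The index h is 1-based: h = 1, ..., n. *)
Definition lam (R : realType) (n : nat) (d s : R) (h : nat) : R :=
  d + 2 * s * cos (h%:R * pi / n.+1%:R).

(* On column vectors ('cV[R]_n = 'M[R]_(n, 1)) this is the Euclidean norm.
   The canonical norm `|A| on matrices is the entrywise maximum instead. *)
Definition normF (R : realType) (m n : nat) (A : 'M[R]_(m, n)) : R :=
  Num.sqrt (\sum_(i < m) \sum_(j < n) A i j ^+ 2).

Definition norm2 (R : realType) (n : nat) (A : 'M[R]_n) : R :=
  sup [set normF (A *m x) | x in [set x : 'cV[R]_n | normF x = 1]].

(* For n >= 2 the infimum is a minimum for the two sets C used below:
   see d2_attained and d2T_attained. *)
Definition dist2 (R : realType) (n : nat) (C : set 'M[R]_n) (A : 'M[R]_n) : R :=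
  inf [set norm2 (A - S) | S in C].

Definition d2 (R : realType) (n : nat) (A : 'M[R]_n) : R :=
  dist2 (@singular R n) A.

Definition d2T (R : realType) (n : nat) (A : 'M[R]_n) : R :=
  dist2 (@singular R n `&` @tridiagToeplitz R n) A.

Definition unit_eigenvector (R : realType) (n : nat) (A : 'M[R]_n) (a : R)
    (x : 'cV[R]_n) : Prop :=
  A *m x = a *: x /\ normF x = 1.

(* kappaT x_h is the structured condition number of lambda_h, for x_h a unit
   eigenvector of T for lambda_h (which exists: unit_eigenvector_exists). The
   supremum is a maximum for n >= 2: see kappaT_attained. *)
Definition kappaT (R : realType) (n : nat) (x : 'cV[R]_n) : R :=
  sup [set `|(x^T *m E *m x) 0 0| | E in
        [set E : 'M[R]_n | tridiagToeplitz E /\ normF E = 1]].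

Section Attained.
Variable R : realType.

Lemma cauchy_schwarz_sum (I : finType) (a b : I -> R) :
  (\sum_i a i * b i) ^+ 2 <= (\sum_i a i ^+ 2) * (\sum_i b i ^+ 2).
Proof.
have : 0 <= \sum_i \sum_j (a i * b j - a j * b i) ^+ 2.
  by apply: sumr_ge0 => i _; apply: sumr_ge0 => j _; exact: sqr_ge0.
suff -> : \sum_i \sum_j (a i * b j - a j * b i) ^+ 2 =
  2 * ((\sum_i a i ^+ 2) * (\sum_i b i ^+ 2) - (\sum_i a i * b i) ^+ 2).
  by rewrite pmulr_rge0 // subr_ge0.
have sumM (u v : I -> R) :
  (\sum_i u i) * (\sum_i v i) = \sum_i \sum_j u i * v j.
  by rewrite mulr_suml; apply: eq_bigr => i _; rewrite mulr_sumr.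
rewrite expr2 mulrDr mulrN [2 * _]mulr_natl mulr2n.
rewrite {2}[(\sum_i a i ^+ 2) * _]mulrC !sumM mulr_sumr -sumrN -!big_split /=.
apply: eq_bigr => i _; rewrite mulr_sumr -sumrN -!big_split /=.
by apply: eq_bigr => j _; ring.
Qed.

Lemma normFE m n (A : 'M[R]_(m, n)) :
  normF A = Num.sqrt (\sum_(p : 'I_m * 'I_n) A p.1 p.2 ^+ 2).
Proof. by rewrite /normF pair_bigA. Qed.

Lemma normF_ge0 m n (A : 'M[R]_(m, n)) : 0 <= normF A.
Proof. exact: sqrtr_ge0. Qed.

Lemma normFD m n (A B : 'M[R]_(m, n)) : normF (A + B) <= normF A + normF B.
Proof.
rewrite -(ler_pXn2r (_ : 0 < 2)%N) ?nnegrE ?addr_ge0 ?normF_ge0 //.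
rewrite !normFE sqrrD !sqr_sqrtr ?sumr_ge0 // => [|? _|? _|? _]; rewrite ?sqr_ge0 //.
under eq_bigr do rewrite mxE sqrrD.
rewrite !big_split /= lerD2r lerD2l -mulr2n lerMn2r /=.
rewrite -sqrtrM ?sumr_ge0 // => [|? _]; last exact: sqr_ge0.
apply: le_trans (ler_norm _) _; rewrite -sqrtr_sqr ler_wsqrtr //; exact: cauchy_schwarz_sum.
Qed.

Lemma normF_coord m n (A : 'M[R]_(m, n)) i j : `|A i j| <= normF A.
Proof.
rewrite normFE -sqrtr_sqr ler_wsqrtr // (bigD1 (i, j)) //= lerDl.
by apply: sumr_ge0 => p _; exact: sqr_ge0.
Qed.

Lemma normF_le m n (A : 'M[R]_(m, n)) c : 0 <= c ->
  (forall i j, `|A i j| <= c) -> normF A <= (m * n)%:R * c.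
Proof.
move=> c0 Ac; have M0 : 0 <= (m * n)%:R * c by rewrite mulr_ge0.
rewrite -(ler_pXn2r (_ : 0 < 2)%N) ?nnegrE ?normF_ge0 // normFE sqr_sqrtr; last first.
  by apply: sumr_ge0 => p _; exact: sqr_ge0.
apply: (@le_trans _ _ (\sum_(p : 'I_m * 'I_n) c ^+ 2)).
  apply: ler_sum => p _; rewrite -real_normK ?num_real //.
  by rewrite ler_pXn2r ?nnegrE.
rewrite sumr_const card_prod !card_ord exprMn -[leLHS]mulr_natl ler_wpM2r ?sqr_ge0 //.
by rewrite -natrX ler_nat; case: (m * n)%N => // p; rewrite leq_pmulr.
Qed.

Lemma normFN m n (A : 'M[R]_(m, n)) : normF (- A) = normF A.
Proof. by rewrite !normFE; under eq_bigr do rewrite mxE sqrrN. Qed.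

Section Norm2.
Variable n : nat.
Hypothesis n0 : (0 < n)%N.
Implicit Types A B : 'M[R]_n.

Let U := [set x : 'cV[R]_n | normF x = 1].

Lemma normF_delta j : normF (delta_mx j 0 : 'cV[R]_n) = 1.
Proof.
rewrite /normF (bigD1 j) //= big_ord1 mxE !eqxx expr1n big1 ?addr0 ?sqrtr1 //.
by move=> i ij; rewrite big_ord1 mxE (negPf ij) expr0n.
Qed.

Lemma norm2_bound A c : 0 <= c -> (forall i j, `|A i j| <= c) ->
  forall x, U x -> normF (A *m x) <= (n * n)%:R * c.
Proof.
move=> c0 Ac x Ux.
apply: (@le_trans _ _ ((n * 1)%:R * (n%:R * c))); last first.
  by rewrite muln1 natrM mulrA.
apply: normF_le => [|i k]; first by rewrite mulr_ge0.
rewrite mxE (le_trans (ler_norm_sum _ _ _)) //.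
apply: (@le_trans _ _ (\sum_(j < n) c)); last first.
  by rewrite sumr_const card_ord mulr_natl.
apply: ler_sum => j _; rewrite normrM -[leRHS]mulr1.
by rewrite ler_pM // -[leRHS]Ux normF_coord.
Qed.

Lemma norm2_le A c : (forall x, U x -> normF (A *m x) <= c) -> norm2 A <= c.
Proof.
move=> H; apply: ge_sup; last by move=> _ [x Ux <-]; exact: H.
exists (normF (A *m (delta_mx (Ordinal n0) 0 : 'cV[R]_n))), (delta_mx (Ordinal n0) 0) => //.
exact: normF_delta.
Qed.

Lemma norm2_ub A x : U x -> normF (A *m x) <= norm2 A.
Proof.
move=> Ux; apply: ub_le_sup; last by exists x.
exists ((n * n)%:R * normF A) => _ [y Uy <-].
apply: norm2_bound => //; [exact: normF_ge0 | exact: normF_coord].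
Qed.

Lemma norm2_coord A i j : `|A i j| <= norm2 A.
Proof.
apply: le_trans (norm2_ub A (normF_delta j)).
by rewrite -colE; apply: le_trans (normF_coord _ i 0); rewrite mxE.
Qed.

Lemma norm2_ge0 A : 0 <= norm2 A.
Proof. exact: le_trans (normF_ge0 _) (norm2_ub A (normF_delta (Ordinal n0))). Qed.

Lemma norm2D A B : norm2 (A + B) <= norm2 A + norm2 B.
Proof.
apply: norm2_le => x Ux; rewrite mulmxDl (le_trans (normFD _ _)) //.
by rewrite lerD ?norm2_ub.
Qed.

Lemma norm2N A : norm2 (- A) = norm2 A.
Proof.
by congr sup; apply/seteqP; split=> _ [x Ux <-]; exists x => //;
  rewrite ?mulNmx ?normFN.
Qed.

Lemma norm2_mxnorm A : norm2 A <= (n * n)%:R * `|A|.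
Proof.
apply: norm2_le => x Ux; apply: norm2_bound => // i j.
rewrite [leRHS]/Num.norm /= mx_normrE.
by apply/bigmax_geP; right; exists (i, j).
Qed.

Lemma norm2_dist A B : `|norm2 A - norm2 B| <= norm2 (A - B).
Proof.
rewrite ler_norml; have := norm2D (A - B) B; have := norm2D (B - A) A.
by rewrite !subrK -[B - A]opprB norm2N => ? ?; apply/andP; split; lra.
Qed.

Lemma vec_mx_norm (v : 'rV[R]_(n * n)) : `|vec_mx v : 'M[R]_n| <= `|v|.
Proof.
rewrite [leLHS]/Num.norm /= mx_normrE; apply/bigmax_leP; split=> // -[i j] _ /=.
rewrite mxE [leRHS]/Num.norm /= mx_normrE.
by apply/bigmax_geP; right; exists (0, mxvec_index i j).
Qed.

Lemma norm2_vec_continuous A :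
  continuous (fun v : 'rV[R]_(n * n) => norm2 (A - vec_mx v)).
Proof.
have N0 : 0 < (n * n)%:R :> R by rewrite ltr0n muln_gt0 n0.
move=> v; apply/(@cvgrPdist_le _ _ _ (nbhs (v : 'rV[R]_(n * n))) (nbhs_filter v)) => e e0; near=> w.
apply: le_trans (norm2_dist _ _) _.
rewrite opprB addrC addrA subrK -linearB /= (le_trans (norm2_mxnorm _)) //.
apply: (@le_trans _ _ ((n * n)%:R * `|w - v|)).
  by rewrite ler_wpM2l // vec_mx_norm.
rewrite -ler_pdivlMl // mulrC distrC.
near: w; exact: (@cvgr_dist_le _ _ _ (nbhs (v : 'rV[R]_(n * n))) (nbhs_filter v) id v (fun _ => id) _ (divr_gt0 e0 N0)).
Unshelve. all: by end_near. Qed.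

Lemma dist2_attained (C : set 'M[R]_n) A : C !=set0 ->
  closed [set v : 'rV[R]_(n * n) | C (vec_mx v)] ->
  exists2 S, C S & norm2 (A - S) = dist2 C A.
Proof.
move=> [S0 CS0] clC.
pose f (v : 'rV[R]_(n * n)) := norm2 (A - vec_mx v).
pose K := [set v | C (vec_mx v)] `&` [set v | f v <= norm2 (A - S0)].
have K0 : K !=set0 by exists (mxvec S0); split; rewrite /= /f mxvecK.
have clK : closed K.
  apply: closedI => //; apply: (@preimage_closed _ _ f [set x | x <= norm2 (A - S0)]).
    by move=> x _; exact: norm2_vec_continuous.
  exact: closed_le.
have bK : bounded_set K.
  exists (norm2 A + norm2 (A - S0)); split; first exact: num_real.
  move=> M HM v [_ /= fv]; apply: le_trans (ltW HM).
  rewrite [leLHS]/Num.norm /= mx_normrE; apply/bigmax_leP; split.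
    by rewrite addr_ge0 ?norm2_ge0.
  move=> [i j] _ /=; rewrite (ord1 i); case/mxvec_indexP: j => k l.
  have -> : v 0 (mxvec_index k l) = (vec_mx v) k l by rewrite mxE.
  apply: le_trans (norm2_coord _ _ _) _.
  have -> : vec_mx v = A + - (A - vec_mx v) by rewrite opprB addrC subrK.
  by rewrite (le_trans (norm2D _ _)) // norm2N lerD2l.
have [c cK cmin] := EVT_min_rV K0 (bounded_closed_compact bK clK)
  (continuous_subspaceT (@norm2_vec_continuous A)).
move/set_mem: cK => [Cc fc].
exists (vec_mx c) => //; apply/eqP; rewrite eq_le; apply/andP; split.
  apply: lb_le_inf; first by exists (norm2 (A - S0)), S0.
  move=> _ [S CS <-]; have [le|lt] := leP (norm2 (A - S)) (norm2 (A - S0)).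
    have /cmin : mxvec S \in K by apply/mem_set; split; rewrite /= /f mxvecK.
    by rewrite mxvecK.
  exact: le_trans fc (ltW lt).
apply: ge_inf; last by exists (vec_mx c).
by exists 0 => _ [S _ <-]; exact: norm2_ge0.
Qed.

Lemma det_continuous (T : topologicalType) (f : T -> 'M[R]_n) :
  (forall i j, continuous (fun t => f t i j)) -> continuous (fun t => \det (f t)).
Proof.
move=> fc t; apply: cvg_big => [|s _]; first exact: add_continuous.
apply: cvgMl_tmp; apply: cvg_big => [|i _ /=]; first exact: mul_continuous.
exact: fc.
Qed.

Lemma vec_coord_continuous i j :
  continuous (fun v : 'rV[R]_(n * n) => (vec_mx v : 'M[R]_n) i j).
Proof.
rewrite (_ : (fun v => _) = (fun v : 'rV[R]_(n * n) => v 0 (mxvec_index i j))).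
  exact: coord_continuous.
by apply/funext => v; rewrite mxE.
Qed.

Lemma closed_singular : closed [set v : 'rV[R]_(n * n) | singular (vec_mx v)].
Proof.
rewrite (_ : mkset _ = (fun v : 'rV[R]_(n * n) => \det (vec_mx v)) @^-1` [set 0]).
  apply: preimage_closed; last exact: closed_eq.
  by move=> x _; apply: det_continuous => i j; exact: vec_coord_continuous.
apply/seteqP; split=> v; rewrite /singular /= unitmxE unitfE.
  by move/negPn/eqP.
by move=> ->; rewrite eqxx.
Qed.

Lemma singular0 : singular (0 : 'M[R]_n).
Proof. by case: n n0 => // p _; rewrite /singular /= unitmxE det0 unitr0. Qed.

Lemma tridiag0 : tridiag n 0 0 = 0 :> 'M[R]_n.
Proof. by apply/matrixP => i j; rewrite !mxE; case: ifP => // _; case: ifP. Qed.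

End Norm2.

Lemma continuous_sub_for (T : topologicalType) (f g : T -> R) t :
  {for t, continuous f} -> {for t, continuous g} ->
  {for t, continuous (fun t => f t - g t)}.
Proof. by move=> fc gc; exact: cvgB. Qed.

Lemma tridiagToeplitzE n (A : 'M[R]_n.+2) :
  tridiagToeplitz A <-> forall i j, A i j = tridiag n.+2 (A 0 0) (A 0 1) i j.
Proof.
split; last by move=> H; exists (A 0 0), (A 0 1); apply/matrixP.
by move=> [d [s ->]] i j; rewrite !mxE.
Qed.

Lemma closed_tridiagToeplitz n : (1 < n)%N ->
  closed [set v : 'rV[R]_(n * n) | tridiagToeplitz (vec_mx v)].
Proof.
case: n => [//|[//|n]] _.
rewrite (_ : mkset _ = \bigcap_(p : 'I_n.+2 * 'I_n.+2)
   (fun v : 'rV[R]_(n.+2 * n.+2) => (vec_mx v) p.1 p.2 -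
     tridiag n.+2 ((vec_mx v) 0 0) ((vec_mx v) 0 1) p.1 p.2) @^-1` [set 0]).
  apply: closed_bigI => -[i j] _; apply: preimage_closed; last exact: closed_eq.
  have vc := @vec_coord_continuous n.+2.
  move=> v _; apply: continuous_sub_for; first exact: vc.
  rewrite (_ : (fun v => _) = (fun v : 'rV[R]_(n.+2 * n.+2) =>
    if i == j then (vec_mx v) 0 0
    else if ((i.+1 == j :> nat) || (j.+1 == i :> nat))%N then (vec_mx v) 0 1
    else 0)).
    case: (i == j); first exact: vc.
    by case: (_ || _); [exact: vc | exact: cst_continuous].
  by apply/funext => w; rewrite mxE.
apply/seteqP; split=> v /=.
  by move/tridiagToeplitzE => H p _ /=; rewrite -H subrr.
move=> H; apply/tridiagToeplitzE => i j; apply/eqP; rewrite -subr_eq0; apply/eqP.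
exact: (H (i, j)).
Qed.

Lemma d2_attained n (A : 'M[R]_n) : (2 <= n)%N ->
  exists2 S, singular S & norm2 (A - S) = d2 A.
Proof.
move=> n2; have n0 := ltnW n2; apply: dist2_attained => //.
  by exists 0; exact: singular0.
exact: closed_singular.
Qed.

Lemma d2T_attained n (A : 'M[R]_n) : (2 <= n)%N ->
  exists2 S, singular S /\ tridiagToeplitz S & norm2 (A - S) = d2T A.
Proof.
move=> n2; have n0 := ltnW n2.
apply: (@dist2_attained _ n0 (@singular R n `&` @tridiagToeplitz R n)) => //.
  exists 0; split; first exact: singular0.
  by exists 0, 0; rewrite tridiag0.
exact: closedI (@closed_singular n) (closed_tridiagToeplitz n2).
Qed.

Lemma normF_continuous n (T : topologicalType) (f : T -> 'M[R]_n) :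
  (forall i j, continuous (fun t => f t i j)) -> continuous (fun t => normF (f t)).
Proof.
move=> fc t; apply: (@continuous_comp _ _ _ _ Num.sqrt); last exact: sqrt_continuous.
apply: cvg_big => [|i _]; first exact: add_continuous.
apply: cvg_big => [|j _]; first exact: add_continuous.
by apply: cvgM; exact: fc.
Qed.

Lemma form_continuous n (T : topologicalType) (f : T -> 'M[R]_n) (x : 'cV[R]_n) :
  (forall i j, continuous (fun t => f t i j)) ->
  continuous (fun t => `|(x^T *m f t *m x) 0 0|).
Proof.
move=> fc t; apply: (@continuous_comp _ _ _ (fun t => (x^T *m f t *m x) 0 0) (fun u : R => `|u|)); last exact: norm_continuous.
rewrite (_ : (fun t => _) =
    fun t => \sum_j (\sum_i x i 0 * f t i j) * x j 0); last first.
  apply/funext => u; rewrite mxE; apply: eq_bigr => j _; rewrite mxE.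
  by congr (_ * _); apply: eq_bigr => i _; rewrite mxE.
apply: cvg_big => [|j _]; first exact: add_continuous.
apply: cvgMr_tmp; apply: cvg_big => [|i _]; first exact: add_continuous.
by apply: cvgMl_tmp; exact: fc.
Qed.

Lemma kappaT_attained n (x : 'cV[R]_n) : (2 <= n)%N ->
  exists2 E : 'M[R]_n, tridiagToeplitz E /\ normF E = 1 &
    `|(x^T *m E *m x) 0 0| = kappaT x.
Proof.
move=> n2; have n0 := ltnW n2.
pose K := [set v : 'rV[R]_(n * n) | tridiagToeplitz (vec_mx v)] `&`
  [set v | normF (vec_mx v : 'M[R]_n) = 1].
pose c : R := Num.sqrt n%:R^-1.
have nc : normF (tridiag n c 0) = 1.
  rewrite /normF (eq_bigr (fun=> n%:R^-1)) => [|i _].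
    by rewrite sumr_const card_ord -[X in Num.sqrt X]mulr_natl mulfV ?sqrtr1 // pnatr_eq0 -lt0n.
  rewrite (bigD1 i) //= mxE eqxx sqr_sqrtr ?invr_ge0 // big1 ?addr0 // => j ji.
  by rewrite mxE eq_sym (negPf ji); case: ifP; rewrite expr0n.
have K0 : K !=set0.
  by exists (mxvec (tridiag n c 0)); split; rewrite /= mxvecK //; exists c, 0.
have clK : closed K.
  apply: closedI; first exact: closed_tridiagToeplitz.
  apply: (@preimage_closed _ _
    (fun v : 'rV[R]_(n * n) => normF (vec_mx v : 'M[R]_n)) [set 1]).
    by move=> v _; apply: normF_continuous => i j; exact: vec_coord_continuous.
  exact: closed_eq.
have bK : bounded_set K.
  exists 1; split; first exact: num_real.
  move=> M HM v [_ /= v1]; apply: le_trans (ltW HM).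
  rewrite [leLHS]/Num.norm /= mx_normrE; apply/bigmax_leP; split => //.
  move=> [i j] _ /=; rewrite (ord1 i); case/mxvec_indexP: j => k l.
  have -> : v 0 (mxvec_index k l) = (vec_mx v) k l by rewrite mxE.
  by rewrite -v1 normF_coord.
have fc : continuous
    (fun v : 'rV[R]_(n * n) => `|(x^T *m vec_mx v *m x) 0 0|).
  by apply: form_continuous => i j; exact: vec_coord_continuous.
have [v vK vmax] := EVT_max_rV K0 (bounded_closed_compact bK clK)
  (continuous_subspaceT fc).
have {}vmax E : tridiagToeplitz E -> normF E = 1 ->
    `|(x^T *m E *m x) 0 0| <= `|(x^T *m vec_mx v *m x) 0 0|.
  move=> TE E1; have := vmax (mxvec E); rewrite mxvecK; apply.
  by apply/mem_set; split; rewrite /= mxvecK.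
move/set_mem: vK => [Tv v1].
exists (vec_mx v) => //; apply/eqP; rewrite eq_le; apply/andP; split.
  apply: ub_le_sup; last by exists (vec_mx v).
  by exists (`|(x^T *m vec_mx v *m x) 0 0|) => _ [E [TE E1] <-]; exact: vmax.
apply: ge_sup; first by exists (`|(x^T *m vec_mx v *m x) 0 0|), (vec_mx v).
by move=> _ [E [TE E1] <-]; exact: vmax.
Qed.

Lemma sin_natmul_pi h : sin (h%:R * pi) = 0 :> R.
Proof.
elim: h => [|h IH]; first by rewrite mul0r sin0.
by rewrite -natr1 mulrDl mul1r sinDpi IH oppr0.
Qed.

Lemma unit_eigenvector_exists n (d s : R) h : (1 <= h <= n)%N ->
  exists x, unit_eigenvector (tridiag n d s) (lam n d s h) x.
Proof.
move=> /andP[h1 hn].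
pose th : R := h%:R * pi / n.+1%:R.
have th0 : 0 < th by rewrite divr_gt0 ?mulr_gt0 ?pi_gt0 ?ltr0n.
have thpi : th < pi.
  by rewrite /th mulrAC gtr_pMl ?pi_gt0 // ltr_pdivrMr ?ltr0n // mul1r ltr_nat ltnS.
have thn : n.+1%:R * th = h%:R * pi by rewrite /th mulrCA divff ?mulr1 // pnatr_eq0.
pose v : 'cV[R]_n := \col_i sin (i.+1%:R * th).
have Tv : tridiag n d s *m v = lam n d s h *: v.
  apply/colP => i; rewrite !mxE.
  rewrite (eq_bigr (fun j : 'I_n => d * ((i == j)%:R * v j 0) +
     s * ((i.+1 == j :> nat)%:R * v j 0 + (j.+1 == i :> nat)%:R * v j 0))); last first.
    move=> j _; rewrite mxE; have [->|ij] := eqVneq i j.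
      by rewrite gtn_eqF // !mul0r addr0 mulr0 addr0 mul1r.
    rewrite mul0r mulr0 add0r; have [ij1|_] /= := eqVneq i.+1 j.
      have -> : (j.+1 == i :> nat) = false by rewrite -ij1 gtn_eqF // ltnW.
      by rewrite mul1r mul0r addr0.
    by case: (_ == _); rewrite !(mul0r, mul1r, mulr0, add0r).
  rewrite big_split /= -!mulr_sumr big_split /=.
  have -> : \sum_(j < n) (i == j)%:R * v j 0 = sin (i.+1%:R * th).
    rewrite (bigD1 i) //= eqxx mul1r big1 ?addr0 ?mxE // => j ji.
    by rewrite eq_sym (negPf ji) mul0r.
  have -> : \sum_(j < n) (i.+1 == j :> nat)%:R * v j 0 = sin (i.+2%:R * th).
    have [lt|ge] := ltnP i.+1 n.
      rewrite (bigD1 (Ordinal lt)) //= eqxx mul1r big1 ?addr0 ?mxE // => j ji.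
      by rewrite eq_sym (_ : (j == i.+1 :> nat) = false) ?mul0r //; exact/negbTE.
    have -> : i.+2 = n.+1 by congr S; apply/eqP; rewrite eqn_leq ge ltn_ord.
    rewrite thn sin_natmul_pi big1 // => j _.
    by rewrite gtn_eqF ?mul0r // (leq_trans (ltn_ord j)).
  have -> : \sum_(j < n) (j.+1 == i :> nat)%:R * v j 0 = sin (i%:R * th).
    case: i => -[|i] Hi /=.
      by rewrite mul0r sin0 big1 // => j _; rewrite mul0r.
    rewrite (bigD1 (Ordinal (ltnW Hi))) //= eqxx mul1r big1 ?addr0 ?mxE // => j ji.
    by rewrite eqSS (_ : (j == i :> nat) = false) ?mul0r //; exact/negbTE.
  rewrite /lam -/th -[i.+2]addn1 -[i.+1]addn1 !natrD.
  rewrite (_ : i%:R * th = (i%:R + 1%:R) * th - th); last by ring.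
  rewrite (_ : (i%:R + 1%:R + 1%:R) * th = (i%:R + 1%:R) * th + th); last by ring.
  by rewrite sinD sinB; ring.
have n0 : (0 < n)%N := leq_trans h1 hn.
have v0 : 0 < normF v.
  apply: lt_le_trans (normF_coord v (Ordinal n0) 0).
  by rewrite mxE mul1r normr_gt0 gt_eqF // sin_gt0_pi // th0 thpi.
exists ((normF v)^-1 *: v); split; first by rewrite -scalemxAr Tv !scalerA mulrC.
rewrite {1}normFE (eq_bigr (fun p => (normF v) ^- 2 * v p.1 p.2 ^+ 2)) => [|p _].
  rewrite -mulr_sumr sqrtrM ?invr_ge0 ?sqr_ge0 // -normFE sqrtrV ?sqr_ge0 //.
  by rewrite sqrtr_sqr gtr0_norm // mulVf // gt_eqF.
by rewrite mxE exprMn exprVn.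
Qed.

End Attained.

(* Main.v *)
Require Import Defs.
From HB Require Import structures.
From mathcomp Require Import all_boot all_order all_algebra.
From mathcomp Require Import all_classical all_reals all_analysis.
From mathcomp Require Import ring.
Import Order.TTheory GRing.Theory Num.Theory.
Import numFieldNormedType.Exports.
Local Open Scope classical_set_scope.
Local Open Scope ring_scope.

(** For sigma nonzero the matrix T is symmetric with n distinct eigenvalues,
because the cosine is injective on [0, pi]; an orthonormal basis of eigenvectors
therefore diagonalizes it (tridiag_spectral), and any bounds m <= |lambda_j| <= M
on the spectrum give m |y| <= |T y| <= M |y| for every vector y.

If S is singular and y is a unit vector in its kernel, then
|T - S|_2 >= |(T - S) y| = |T y| >= |lambda_k| (d2_tridiag_ge). The deflation
S = T - lambda_k v v^T, with v a unit eigenvector for lambda_k, is singular at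
distance at most |lambda_k| (d2_le_eigenvalue), so d_2(T) = |lambda_k|.
Restricting the competitors to Toeplitz ones can only increase the distance.

For the upper bound (d2T_tridiag_le) write c for the cosine attached to the
index h. The matrix E = (n; n-1, n c) is the optimal perturbation direction for
lambda_h among tridiagonal Toeplitz matrices: it is proportional to the
projection of x x^T onto that subspace, x being a unit eigenvector for lambda_h.
Its own h-th eigenvalue is n - 1 + 2 n c^2 > 0, so with
t = lambda_h / (n - 1 + 2 n c^2) the matrix T - t E has h-th eigenvalue 0 and is
singular. Its distance to T is |t| |E|_2, and
|E|_2 <= n - 1 + 2 n |c| cos(pi/(n+1)) (norm2_tridiag_le), since the spectral
radius of (n; 0, 1) is 2 cos(pi/(n+1)). *)

(** * Euclidean norms *)

Lemma normF_sqr {R : realType} {n : nat} (y : 'cV[R]_n) :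
  normF y ^+ 2 = \sum_i y i 0 ^+ 2.
Proof.
rewrite /normF sqr_sqrtr; first by apply: eq_bigr => i _; rewrite big_ord1.
by apply: sumr_ge0 => i _; apply: sumr_ge0 => j _; exact: sqr_ge0.
Qed.

Lemma normF_sqr_dot {R : realType} {n : nat} (y : 'cV[R]_n) :
  normF y ^+ 2 = (y^T *m y) 0 0.
Proof.
by rewrite normF_sqr mxE; apply: eq_bigr => i _; rewrite mxE expr2.
Qed.

Lemma normFZ {R : realType} {n : nat} (a : R) (y : 'cV[R]_n) :
  normF (a *: y) = `|a| * normF y.
Proof.
apply/eqP; rewrite -(@eqrXn2 _ 2) ?mulr_ge0 ?normF_ge0 //; apply/eqP.
rewrite exprMn real_normK ?num_real // !normF_sqr mulr_sumr.
by apply: eq_bigr => i _; rewrite mxE exprMn.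
Qed.

Lemma normF_gt0 {R : realType} {n : nat} (y : 'cV[R]_n) :
  y != 0 -> 0 < normF y.
Proof.
case/cV0Pn => i yi0; apply: lt_le_trans (normF_coord y i 0).
by rewrite normr_gt0.
Qed.

Lemma normF1_neq0 {R : realType} {n : nat} (y : 'cV[R]_n) :
  normF y = 1 -> y != 0.
Proof.
apply: contra_eq_neq => ->.
by rewrite -(scale0r 0) normFZ normr0 mul0r eq_sym oner_neq0.
Qed.

Lemma normF_isometry {R : realType} {n : nat} (U : 'M[R]_n) (y : 'cV[R]_n) :
  U^T *m U = 1%:M -> normF (U *m y) = normF y.
Proof.
move=> UU; apply/eqP; rewrite -(@eqrXn2 _ 2) ?normF_ge0 //; apply/eqP.
by rewrite !normF_sqr_dot trmx_mul mulmxA -(mulmxA y^T) UU mulmx1.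
Qed.

Lemma dot_le_normF {R : realType} {n : nat} (u v : 'cV[R]_n) :
  `|(u^T *m v) 0 0| <= normF u * normF v.
Proof.
rewrite -(@ler_pXn2r _ 2) ?nnegrE ?mulr_ge0 ?normF_ge0 //.
rewrite real_normK ?num_real // exprMn !normF_sqr mxE.
apply: le_trans (cauchy_schwarz_sum (fun i => u i 0) (fun i => v i 0)).
by under eq_bigr do rewrite mxE.
Qed.

Lemma singularP {R : realType} {n : nat} (S : 'M[R]_n) :
  singular S <-> exists2 y : 'cV[R]_n, y != 0 & S *m y = 0.
Proof.
split=> [Ssing|[y y0 Sy0]].
  have /det0P[v v0 vS] : \det S^T == 0.
    by move: Ssing; rewrite /singular /= unitmxE unitfE negbK det_tr.
  exists v^T; first by rewrite trmx_eq0.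
  by rewrite -[S]trmxK -trmx_mul vS trmx0.
apply/negP => Su; move/eqP: y0; apply.
by rewrite -[y](mulKmx Su) Sy0 mulmx0.
Qed.

Lemma singular_unit_kernel {R : realType} {n : nat} (S : 'M[R]_n) :
  singular S -> exists2 y : 'cV[R]_n, normF y = 1 & S *m y = 0.
Proof.
move=> /singularP[y y0 Sy]; have ny := normF_gt0 _ y0.
exists ((normF y)^-1 *: y); last by rewrite -scalemxAr Sy scaler0.
by rewrite normFZ gtr0_norm ?invr_gt0 // mulVf // gt_eqF.
Qed.

(** * The spectrum of a tridiagonal Toeplitz matrix *)

Lemma eigen_angle {R : realType} {n j : nat} : (j <= n.+1)%N ->
  (j%:R * pi / n.+1%:R : R) \in `[0, pi].
Proof.
move=> jn; rewrite in_itv /=; apply/andP; split.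
  by rewrite divr_ge0 ?mulr_ge0 ?pi_ge0.
by rewrite ler_pdivrMr ?ltr0n // mulrC ler_wpM2l ?pi_ge0 // ler_nat.
Qed.

Lemma lam_inj {R : realType} {n : nat} (d s : R) (i j : nat) : s != 0 ->
  (i <= n.+1)%N -> (j <= n.+1)%N -> lam n d s i = lam n d s j -> i = j.
Proof.
move=> s0 ile jle /addrI.
have s2 : 2 * s != 0 by rewrite mulf_neq0 ?pnatr_eq0.
move/(mulfI s2).
move/(cos_inj (eigen_angle ile) (eigen_angle jle)).
have n0 : n.+1%:R^-1 != 0 :> R by rewrite invr_neq0 // pnatr_eq0.
move/(mulIf n0)/(mulIf (lt0r_neq0 (pi_gt0 R)))/eqP.
by rewrite eqr_nat => /eqP.
Qed.

(** The angle j pi / (n+1) lies in [pi/(n+1), pi - pi/(n+1)], where the cosine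
decreases; the bound below -1 comes from the reflection a |-> pi - a, which
exchanges the indices j and n+1-j. *)
Lemma abs_cos_eigen_angle {R : realType} {n j : nat} : (1 <= j <= n)%N ->
  `|cos (j%:R * pi / n.+1%:R : R)| <= cos (pi / n.+1%:R).
Proof.
have decr i : (1 <= i <= n.+1)%N ->
    cos (i%:R * pi / n.+1%:R : R) <= cos (pi / n.+1%:R).
  move=> /andP[i1 ile].
  have := @eigen_angle R n 1 isT; rewrite mul1r => a1.
  rewrite leNgt (ltr_cos (eigen_angle ile) a1) -leNgt ler_pM2r ?invr_gt0 ?ltr0n //.
  by rewrite ler_peMl ?pi_ge0 // ler1n.
move=> /andP[j1 jn]; rewrite ler_norml decr ?j1 ?(leq_trans jn) // andbT.
have /decr : (1 <= n.+1 - j <= n.+1)%N by rewrite subn_gt0 ltnS jn leq_subr.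
rewrite natrB ?(leq_trans jn) // mulrBl mulrBl mulrAC divff ?pnatr_eq0 // mul1r.
by rewrite cosB cospi sinpi mul0r addr0 mulN1r lerNl.
Qed.

Lemma tridiag_sym {R : realType} {n : nat} (d s : R) :
  (tridiag n d s)^T = tridiag n d s.
Proof. by apply/matrixP => i j; rewrite !mxE eq_sym orbC. Qed.

Lemma tridiagB {R : realType} {n : nat} (d s d' s' : R) :
  tridiag n d s - tridiag n d' s' = tridiag n (d - d') (s - s').
Proof.
apply/matrixP => i j; rewrite !mxE; case: ifP => // _.
by case: ifP => // _; rewrite subrr.
Qed.

Lemma tridiag_split {R : realType} {n : nat} (d s : R) :
  tridiag n d s = d%:M + s *: tridiag n 0 1.
Proof.
apply/matrixP => i j; rewrite !mxE; case: ifP => _; first by rewrite mulr0 addr0.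
by rewrite add0r; case: ifP => _; rewrite ?mulr1 ?mulr0.
Qed.

Lemma eigenvectors_orthogonal {R : realType} {n : nat} (A : 'M[R]_n) (a b : R)
    (u v : 'cV[R]_n) : A^T = A -> a != b ->
  A *m u = a *: u -> A *m v = b *: v -> (u^T *m v) 0 0 = 0.
Proof.
move=> Asym ab Au Av.
have : a * (u^T *m v) 0 0 = b * (u^T *m v) 0 0.
  have : u^T *m A *m v = u^T *m A *m v := erefl.
  rewrite -{1}Asym -trmx_mul Au -mulmxA Av linearZ /= -scalemxAl -scalemxAr.
  by move/matrixP/(_ 0 0); rewrite !mxE.
by move/eqP; rewrite -subr_eq0 -mulrBl mulf_eq0 subr_eq0 (negPf ab) => /eqP.
Qed.

(** Orthogonal diagonalization: w collects the coordinates of y on an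
orthonormal eigenbasis, so passing from y to w preserves the norm. *)
Lemma tridiag_spectral {R : realType} {n : nat} (d s : R) (y : 'cV[R]_n) :
  s != 0 -> exists w : 'cV[R]_n,
    normF w = normF y /\
    normF (tridiag n d s *m y) = normF (\col_j (lam n d s j.+1 * w j 0)).
Proof.
move=> s0; set A := tridiag n d s.
have idx (j : 'I_n) : (1 <= j.+1 <= n)%N by rewrite /= ltn_ord.
have [v hv] : exists v : 'I_n -> 'cV[R]_n,
    forall j : 'I_n, unit_eigenvector A (lam n d s j.+1) (v j).
  pose ev (j : 'I_n) := cid (unit_eigenvector_exists d s (idx j)).
  by exists (fun j => projT1 (ev j)) => j; exact: projT2 (ev j).
pose Q := \matrix_(i, j) v j i 0.
have dotQ i j : (Q^T *m Q) i j = ((v i)^T *m v j) 0 0.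
  by rewrite !mxE; apply: eq_bigr => l _; rewrite !mxE.
have QQ : Q^T *m Q = 1%:M.
  apply/matrixP => i j; rewrite dotQ [RHS]mxE; have [<-|ij] := eqVneq i j.
    by rewrite -normF_sqr_dot (hv i).2 expr1n.
  apply: (eigenvectors_orthogonal A _ _ _ _ (tridiag_sym d s) _ (hv i).1 (hv j).1).
  apply: contra ij => /eqP /lam_inj eqij; apply/eqP/val_inj/succn_inj.
  by apply: eqij => //; exact: ltnW (ltn_ord _).
have QQ' := mulmx1C QQ.
pose D := diag_mx (\row_(j < n) lam n d s j.+1).
have AQ : A *m Q = Q *m D.
  apply/matrixP => i j; rewrite mul_mx_diag !mxE mulrC.
  have /matrixP/(_ i 0) := (hv j).1; rewrite [LHS]mxE [RHS]mxE => <-.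
  by apply: eq_bigr => l _; rewrite !mxE.
exists (Q^T *m y); split; first by rewrite normF_isometry // trmxK.
rewrite -{1}[y]mul1mx -QQ' -mulmxA mulmxA AQ -mulmxA normF_isometry //.
rewrite mul_diag_mx; congr normF; apply/matrixP => i j.
by rewrite (ord1 j) [LHS]mxE [RHS]mxE mxE.
Qed.

Lemma tridiag_norm_ge {R : realType} {n : nat} (d s m : R) (y : 'cV[R]_n) :
  s != 0 -> 0 <= m -> (forall j, (1 <= j <= n)%N -> m <= `|lam n d s j|) ->
  m * normF y <= normF (tridiag n d s *m y).
Proof.
move=> s0 m0 mle; have [w [<- ->]] := tridiag_spectral d s y s0.
rewrite -(@ler_pXn2r _ 2) ?nnegrE ?mulr_ge0 ?normF_ge0 //.
rewrite exprMn !normF_sqr mulr_sumr; apply: ler_sum => j _.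
rewrite mxE exprMn ler_wpM2r ?sqr_ge0 // -[leRHS]real_normK ?num_real //.
by rewrite ler_pXn2r ?nnegrE // mle //= ltn_ord.
Qed.

Lemma tridiag_norm_le {R : realType} {n : nat} (d s M : R) (y : 'cV[R]_n) :
  s != 0 -> 0 <= M -> (forall j, (1 <= j <= n)%N -> `|lam n d s j| <= M) ->
  normF (tridiag n d s *m y) <= M * normF y.
Proof.
move=> s0 M0 leM; have [w [<- ->]] := tridiag_spectral d s y s0.
rewrite -(@ler_pXn2r _ 2) ?nnegrE ?mulr_ge0 ?normF_ge0 //.
rewrite exprMn !normF_sqr mulr_sumr; apply: ler_sum => j _.
rewrite mxE exprMn ler_wpM2r ?sqr_ge0 // -[leLHS]real_normK ?num_real //.
by rewrite ler_pXn2r ?nnegrE // leM //= ltn_ord.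
Qed.

(** Splitting off the diagonal part covers s = 0 as well, where the
eigenvalues coincide and tridiag_spectral does not apply. *)
Lemma norm2_tridiag_le {R : realType} {n : nat} (d s : R) : (0 < n)%N ->
  norm2 (tridiag n d s) <= `|d| + 2 * `|s| * cos (pi / n.+1%:R).
Proof.
move=> n0; apply: norm2_le => // y ny.
have leM j : (1 <= j <= n)%N -> `|lam n 0 1 j| <= 2 * cos (pi / n.+1%:R) :> R.
  move=> jn; rewrite /lam add0r mulr1 normrM normr_nat.
  by rewrite ler_pM2l ?ltr0n // abs_cos_eigen_angle.
have M0 : 0 <= 2 * cos (pi / n.+1%:R) :> R.
  by apply: le_trans (leM 1%N _) => //; rewrite n0.
rewrite tridiag_split mulmxDl mul_scalar_mx -scalemxAl.
apply: le_trans (normFD _ _) _; rewrite !normFZ ny mulr1 lerD2l.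
rewrite [leRHS]mulrAC [leRHS]mulrC ler_wpM2l //.
by have := tridiag_norm_le 0 1 _ y (oner_neq0 R) M0 leM; rewrite ny mulr1.
Qed.

(** * Distances to singularity *)

Lemma dist2_le {R : realType} {n : nat} (C : set 'M[R]_n) (A S : 'M[R]_n) :
  (0 < n)%N -> C S -> dist2 C A <= norm2 (A - S).
Proof.
move=> n0 CS; apply: ge_inf; last by exists S.
by exists 0 => _ [S' _ <-]; exact: norm2_ge0.
Qed.

(** Deflation: subtracting a v v^T moves the eigenvalue a to 0, and v v^T has
spectral norm 1. *)
Lemma d2_le_eigenvalue {R : realType} {n : nat} (A : 'M[R]_n) (a : R)
    (v : 'cV[R]_n) : (0 < n)%N -> unit_eigenvector A a v -> d2 A <= `|a|.
Proof.
move=> n0 [Av nv].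
have dotE (y : 'cV[R]_n) : v *m (v^T *m y) = (v^T *m y) 0 0 *: v.
  by rewrite {1}[v^T *m y]mx11_scalar mul_mx_scalar.
have Ssing : singular (A - a *: (v *m v^T)).
  apply/singularP; exists v; first exact: normF1_neq0.
  rewrite mulmxBl -scalemxAl -mulmxA dotE -normF_sqr_dot nv expr1n scale1r.
  by rewrite Av subrr.
apply: le_trans (dist2_le _ _ _ n0 Ssing) _.
rewrite opprB addrC subrK; apply: norm2_le => // y ny.
rewrite -scalemxAl -mulmxA dotE !normFZ nv mulr1 ler_piMr //.
by apply: le_trans (dot_le_normF _ _) _; rewrite nv ny mulr1.
Qed.

Lemma d2_tridiag_ge {R : realType} {n : nat} (d s m : R) : (2 <= n)%N ->
  s != 0 -> 0 <= m -> (forall j, (1 <= j <= n)%N -> m <= `|lam n d s j|) ->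
  m <= d2 (tridiag n d s).
Proof.
move=> n2 s0 m0 mle; have [S Ssing <-] := d2_attained (tridiag n d s) n2.
have [y ny Sy] := singular_unit_kernel _ Ssing.
apply: le_trans (norm2_ub (tridiag n d s - S) ny).
rewrite mulmxBl Sy subr0 -[m]mulr1 -ny.
exact: tridiag_norm_ge.
Qed.

Lemma tridiag_singular {R : realType} {n : nat} (d s : R) (j : nat) :
  (1 <= j <= n)%N -> lam n d s j = 0 -> singular (tridiag n d s).
Proof.
move=> jn lam0; have [v [Av nv]] := unit_eigenvector_exists d s jn.
apply/singularP; exists v; first exact: normF1_neq0.
by rewrite Av lam0 scale0r.
Qed.

Lemma d2_le_d2T {R : realType} {n : nat} (A : 'M[R]_n) : (2 <= n)%N ->
  d2 A <= d2T A.
Proof.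
move=> n2; have [S [Ssing _] <-] := d2T_attained A n2.
exact: dist2_le (ltnW n2) Ssing.
Qed.

(** The competitor is T - t E, where E = (n; n-1, n c) and t is the multiple
that cancels the h-th eigenvalue. *)
Lemma d2T_tridiag_le {R : realType} {n : nat} (d s : R) (h : nat) :
  (2 <= n)%N -> (1 <= h <= n)%N ->
  d2T (tridiag n d s) <=
    `|lam n d s h| / (n%:R - 1 + 2 * n%:R * cos (h%:R * pi / n.+1%:R) ^+ 2)
      * (n%:R - 1 + 2 * n%:R * `|cos (h%:R * pi / n.+1%:R)|
                      * cos (pi / n.+1%:R)).
Proof.
move=> n2 hn; have n0 := ltnW n2.
set l := lam n d s h; set c := cos (h%:R * pi / n.+1%:R).
set den := n%:R - 1 + 2 * n%:R * c ^+ 2.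
have n1 : 0 < n%:R - 1 :> R by rewrite subr_gt0 ltr1n.
have den0 : 0 < den by rewrite /den ltr_wpDr // pmulr_rge0 ?sqr_ge0 ?mulr_gt0 ?ltr0n.
pose t := l / den; pose a := n%:R - 1 : R; pose b := n%:R * c.
have Ssing : singular (tridiag n (d - t * a) (s - t * b)).
  apply: (tridiag_singular _ _ h hn).
  have -> : lam n (d - t * a) (s - t * b) h = l - t * den.
    by rewrite /l /lam -/c /den /a /b; ring.
  by rewrite /t divfK ?subrr // gt_eqF.
apply: (le_trans (dist2_le _ _ (tridiag n (d - t * a) (s - t * b)) n0 _)).
  by split => //; exists (d - t * a), (s - t * b).
rewrite tridiagB !opprB !(addrC _ (_ - _)) !subrK.
apply: le_trans (norm2_tridiag_le _ _ n0) _.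
rewrite !normrM normr_nat (gtr0_norm n1) normfV (gtr0_norm den0).
by rewrite le_eqVlt; apply/orP; left; apply/eqP; ring.
Qed.

Theorem mainTheorem5 (R : realType) (n : nat) (delta sigma : R)
    (x : nat -> 'cV[R]_n) (k h : nat)
    (hn : (2 <= n)%N)
    (hsigma : sigma != 0)
    (hx : forall j : nat, (1 <= j <= n)%N ->
      unit_eigenvector (tridiag n delta sigma) (lam n delta sigma j) (x j))
    (hk : (1 <= k <= n)%N)
    (hkmin : forall j : nat, (1 <= j <= n)%N -> j != k ->
      `|lam n delta sigma k| < `|lam n delta sigma j|)
    (hh : (1 <= h <= n)%N)
    (hhmin : forall j : nat, (1 <= j <= n)%N ->
      `|lam n delta sigma h| / kappaT (x h)
        <= `|lam n delta sigma j| / kappaT (x j)) :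
  [/\ `|lam n delta sigma k| = d2 (tridiag n delta sigma),
      d2 (tridiag n delta sigma) <= d2T (tridiag n delta sigma) &
      d2T (tridiag n delta sigma) <=
        `|lam n delta sigma h|
          / (n%:R - 1 + 2 * n%:R * cos (h%:R * pi / n.+1%:R) ^+ 2)
          * (n%:R - 1 + 2 * n%:R * `|cos (h%:R * pi / n.+1%:R)|
                          * cos (pi / n.+1%:R))].
Proof.
split; last exact: d2T_tridiag_le.
- apply/eqP; rewrite eq_le; apply/andP; split.
    apply: d2_tridiag_ge => // j jn.
    by have [->//|jk] := eqVneq j k; exact: ltW (hkmin j jn jk).
  exact: d2_le_eigenvalue (ltnW hn) (hx k hk).
- exact: d2_le_d2T.
Qed.
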